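(* Let $n \ge 1$ and $k \ge 0$ be integers and let $P \subseteq \mathbb{R}^n$ be a polyhedral set. Let $\binom{P}{k}$ denote any polyhedral set contained in $P^k \subseteq \mathbb{R}^{kn}$ that contains exactly one point of each free orbit of the action of the symmetric group $S_k$ on $P^k$ and contains no other points. Then $$\chi\left(\binom{P}{k}\right) = \binom{\chi(P)}{k}.$$
   Context: A pure $j$-cell in $\mathbb{R}^n$ ($0 \le j \le n$) is a non-empty intersection of a finite number of open half-spaces within a $j$-dimensional affine subspace of $\mathbb{R}^n$ (the intersection of zero half-spaces being the whole affine subspace); it may be bounded or unbounded. A polyhedral set in $\mathbb{R}^n$ is a union of finitely many pure cells; equivalently, a subset of $\mathbb{R}^n$ described by a finite Boolean formula involving linear (affine) equations and inequalities in the coordinates. The Euler measure (also called the combinatorial Euler characteristic) $\chi$ is the integer-valued function on polyhedral sets that is additive on disjoint unions and takes the value $(-1)^j$ on every pure $j$-cell, bounded or unbounded (so $\chi(\emptyset)=0$, $\chi$ of a point is $1$, and $\chi$ of an open interval, bounded or not, is $-1$). Thus $\chi(A)=\sum_i (-1)^{\dim C_i}$ for any partition of $A$ into finitely many pure cells $C_i$; this does not depend on the partition. The group $S_k$ acts on $P^k$ by permuting the $k$ components. A free orbit is an orbit of cardinality $k!$, i.e. an orbit of a $k$-tuple of pairwise distinct points of $P$. For $k=0$, $P^0$ is a single point. For an integer $m$, possibly negative, $\binom{m}{k} = m(m-1)\cdots(m-k+1)/k!$. *)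

(* Defs.v *)
From mathcomp Require Import all_boot all_order all_algebra perm.
From mathcomp Require Import all_classical reals.

Import Order.TTheory GRing.Theory Num.Theory.

Local Open Scope classical_set_scope.
Local Open Scope ring_scope.

Section Polyhedral.
Context {R : realType}.

Definition affine_subspace {n : nat} (a : 'rV[R]_n) (V : {vspace 'rV[R]_n}) :
  set 'rV[R]_n := [set x | x - a \in V].

Definition open_half_space {n : nat} (u : 'cV[R]_n) (b : R) :
  set 'rV[R]_n := [set x | b < (x *m u) 0 0].

(* A half-space within the affine subspace is cut out by an ambient half-space;
   an ambient half-space that does not meet the subspace properly contains it
   or misses it, so that non-empty intersections are not affected. *)
Definition pure_cell {n : nat} (j : nat) (C : set 'rV[R]_n) : Prop :=
  exists (a : 'rV[R]_n) (V : {vspace 'rV[R]_n})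
         (m : nat) (u : 'I_m -> 'cV[R]_n) (b : 'I_m -> R),
    [/\ \dim V = j,
        forall i, u i != 0,
        C = affine_subspace a V `&` \bigcap_i open_half_space (u i) (b i)
      & C !=set0].

Definition polyhedral {n : nat} (A : set 'rV[R]_n) : Prop :=
  exists (m : nat) (C : 'I_m -> set 'rV[R]_n),
    (forall i, exists j, pure_cell j (C i)) /\ A = \bigcup_i C i.

Definition is_euler_measure {n : nat} (chi : set 'rV[R]_n -> int) : Prop :=
  (forall A B, polyhedral A -> polyhedral B -> A `&` B = set0 ->
     chi (A `|` B) = chi A + chi B) /\
  (forall j C, pure_cell j C -> chi C = (-1) ^+ j).

(* The defining properties determine the values on polyhedral sets only;
   elsewhere the value is arbitrary. *)
Definition euler_measure {n : nat} : set 'rV[R]_n -> int :=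
  xget (fun=> 0) [set chi | is_euler_measure chi].

(* A point of (R^n)^k is encoded in R^(k * n) through [mxvec]; its i-th
   component is the i-th row of the corresponding k x n matrix. *)
Definition component {n k : nat} (x : 'rV[R]_(k * n)) (i : 'I_k) : 'rV[R]_n :=
  row i (vec_mx x).

Definition cartesian_power {n : nat} (k : nat) (P : set 'rV[R]_n) :
  set 'rV[R]_(k * n) := [set x | forall i, P (component x i)].

Definition permute_components {n k : nat} (s : 'S_k) (x : 'rV[R]_(k * n)) :
  'rV[R]_(k * n) := mxvec (row_perm s (vec_mx x)).

Definition Sk_orbit {n k : nat} (x : 'rV[R]_(k * n)) : set 'rV[R]_(k * n) :=
  range (fun s : 'S_k => permute_components s x).

Definition free_orbit {n k : nat} (P : set 'rV[R]_n)
    (O : set 'rV[R]_(k * n)) : Prop :=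
  (exists2 x, cartesian_power k P x & O = Sk_orbit x) /\ (O #= `I_(k`!))%card.

Definition is_binomial_set {n k : nat} (P : set 'rV[R]_n)
    (Q : set 'rV[R]_(k * n)) : Prop :=
  [/\ polyhedral Q,
      Q `<=` cartesian_power k P,
      forall O, free_orbit P O -> exists x, Q `&` O = [set x]
    & Q `<=` \bigcup_(O in free_orbit P) O].

End Polyhedral.

Definition int_binomial (m : int) (k : nat) : rat :=
  (\prod_(i < k) (m%:~R - i%:R)) / (k`!)%:R.

(* Main.v *)
Require Import Defs.
From mathcomp Require Import all_boot all_order all_algebra perm.
From mathcomp Require Import all_classical reals.
From mathcomp Require Import ring lra.
Import Order.TTheory GRing.Theory Num.Theory.

Local Open Scope classical_set_scope.
Local Open Scope ring_scope.

Set Implicit Arguments.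
Unset Strict Implicit.
Unset Printing Implicit Defensive.

(**
The Euler measure is promoted to an integral: [euler_integral f a] says that f
is an integer combination of indicators of pure cells and that a is the same
combination of the signs (-1)^j of these cells.  Such an integral is linear,
multiplicative over products of spaces ([integral_prod]) and invariant under
injective linear maps ([integral_image]), and the Euler measure of a polyhedral
set is the integral of its indicator ([integral_polyhedral]).

Let F_k be the set of k-tuples of pairwise distinct points of P.  A tuple in
F_(k+1) is a tuple t in F_k together with a point p of P different from the k
components of t, so that
    1_F_(k+1)(p, t) = 1_F_k(t) 1_P(p) - sum_i 1_F_k(t) [p = t_i].
The first term is a product, and each of the k others is the image of F_k under
the injective linear map sending t to (t_i, t).  Hence the integral of 1_F_(k+1)
is that of 1_F_k times chi(P) - k, and F_k has integral
chi(P) (chi(P) - 1) ... (chi(P) - k + 1) ([integral_configurations]).  On the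
other hand F_k is the union of the free orbits, so that the k! images of Q under
the permutations of the components tile it ([binomial_set_multiplicity]), and
the integral of 1_F_k is also k! chi(Q).

What remains is that the Euler measure exists and is computed by the integral.
Both facts rest on [cell_cut]: a hyperplane either leaves a pure j-cell
on one side or inside it, or cuts it into two j-cells and a (j-1)-cell, and
(-1)^j = (-1)^j + (-1)^(j-1) + (-1)^j.  Cutting the whole space by a finite list of
hyperplanes and summing f times the signs of the faces therefore gives the
integral of f, as soon as the list contains the hyperplanes that bound the cells
in one expression of f ([integral_face_sum]).  Two expressions of f share such a
list, so that the integral is unique ([integral_unique]).  The same cutting
partitions every polyhedral set into cells
([polyhedral_partitionable]).
*)

(** * Pure cells and hyperplanes *)

Section Cells.
Context {R : realType} {n : nat}.
Implicit Types (C : set 'rV[R]_n) (V : {vspace 'rV[R]_n}).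
Implicit Types (u : 'cV[R]_n) (h : 'cV[R]_n * R) (x y v : 'rV[R]_n).

Definition form u x : R := (x *m u) 0 0.

Lemma formD u x y : form u (x + y) = form u x + form u y.
Proof. by rewrite /form mulmxDl mxE. Qed.

Lemma formZ u t x : form u (t *: x) = t * form u x.
Proof. by rewrite /form -scalemxAl mxE. Qed.

Lemma formN u x : form u (- x) = - form u x.
Proof. by rewrite /form mulNmx mxE. Qed.

Lemma form_oppr u x : form (- u) x = - form u x.
Proof. by rewrite /form mulmxN mxE. Qed.

(** A pair [h] of a linear form and a level stands for the hyperplane [on h] and
    its two open sides. *)
Definition above h : set 'rV[R]_n := [set x | h.2 < form h.1 x].
Definition on h : set 'rV[R]_n := [set x | form h.1 x = h.2].
Definition below h : set 'rV[R]_n := [set x | form h.1 x < h.2].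

Lemma above_on_below h x : [\/ above h x, on h x | below h x].
Proof.
rewrite /above /on /below /=.
by case: (ltrgtP h.2 (form h.1 x)) => H; [constructor 1|constructor 3|constructor 2].
Qed.

(** Pure cells are handled through their direction space [V] and a list of
    half-spaces.  Unlike in [pure_cell], null linear forms are allowed, so that
    half-spaces can be pulled back along any linear map. *)
Definition cell_of (a : 'rV[R]_n) V (hs : seq ('cV[R]_n * R)) : set 'rV[R]_n :=
  [set x | x - a \in V /\ forall h, h \in hs -> above h x].

Lemma cell_of_rebase a b V hs : b - a \in V -> cell_of a V hs = cell_of b V hs.
Proof.
move=> ba; apply/seteqP; split=> x [xV xh]; split=> //.
  have -> : x - b = (x - a) - (b - a) by rewrite opprB addrA subrK.
  exact: memvB.
by rewrite -(subrK b x) -addrA memvD.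
Qed.

(** In a non-empty cell a half-space given by the null form is the whole space,
    and can be dropped. *)
Lemma pure_cell_cell_of a V hs x :
  cell_of a V hs x -> pure_cell (\dim V) (cell_of a V hs).
Proof.
move=> Cx; have [_ xh] := Cx.
pose hs' := [seq h <- hs | h.1 != 0].
pose t := in_tuple hs'.
exists a, V, (size hs'), (fun i => (tnth t i).1), (fun i => (tnth t i).2).
split=> //; last by exists x.
  by move=> i; have := mem_tnth i t; rewrite mem_filter => /andP[].
apply/seteqP; split=> y [yV yh]; split=> //.
  move=> i _; apply: yh.
  by have := mem_tnth i t; rewrite mem_filter => /andP[].
move=> h hh; have [h0|h0] := eqVneq h.1 0.
  by have := xh h hh; rewrite /above /= /form h0 !mulmx0.
have /tnthP[i ->] : h \in t by rewrite mem_filter h0.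
exact: (yh i I).
Qed.

(** Any point of a cell can serve as the origin of its affine span. *)
Lemma pure_cellE j C x : pure_cell j C -> C x ->
  exists V hs, \dim V = j /\ C = cell_of x V hs.
Proof.
move=> [a [V [m [u [b [dV _ -> _]]]]]] [xV xh].
exists V, [seq (u i, b i) | i : 'I_m]; split=> //.
rewrite -(cell_of_rebase _ xV); apply/seteqP; split=> y [yV yh]; split=> //.
  by move=> h /mapP[i _ ->]; exact: (yh i I).
by move=> i _; apply: (yh (u i, b i)); apply: map_f; rewrite mem_enum.
Qed.

Lemma pure_cell_nonempty j C : pure_cell j C -> C !=set0.
Proof. by move=> [? [? [? [? [? []]]]]]. Qed.

(** A cell is open in its affine span: it contains a short segment around each
    point in each direction of [V]. *)
Lemma cell_of_open a V hs x v : cell_of a V hs x -> v \in V ->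
  exists2 e : R, 0 < e & forall t, `|t| <= e -> cell_of a V hs (x + t *: v).
Proof.
move=> [xV xh] vV.
suff [e e0 eh] : exists2 e : R, 0 < e &
    forall t, `|t| <= e -> forall h, h \in hs -> above h (x + t *: v).
  exists e => // t te; split; last exact: eh.
  by rewrite addrAC memvD // memvZ.
elim: hs xh => [|h hs IH] xh; first by exists 1.
have [|e e0 eh] := IH; first by move=> h' ?; apply: xh; rewrite inE orbC; apply/orP; left.
have := xh h (mem_head _ _); rewrite /above /= => hx.
(* |t| <= d keeps the variation of h.1 below its margin over h.2 at x. *)
pose d := (form h.1 x - h.2) / (1 + `|form h.1 v|).
have v0 : 0 < 1 + `|form h.1 v| by rewrite ltr_pwDl.
have d0 : 0 < d by rewrite divr_gt0 // subr_gt0.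
exists (Num.min e d); first by rewrite lt_min e0.
move=> t; rewrite le_min => /andP[te td] h'; rewrite inE => /orP[/eqP->|]; last exact: eh.
rewrite /above /= formD formZ.
have : `|t * form h.1 v| < form h.1 x - h.2.
  rewrite normrM; apply: (@le_lt_trans _ _ (d * `|form h.1 v|)).
    by rewrite ler_wpM2r.
  rewrite /d -mulrA gtr_pMr ?subr_gt0 // mulrC ltr_pdivrMr // mul1r.
  by rewrite ltr_pwDl.
by rewrite ltr_norml => /andP[]; lra.
Qed.

(** By openness the directions of a cell are recovered from its points, hence so
    is its dimension. *)
Lemma pure_cell_dim_unique j k C : pure_cell j C -> pure_cell k C -> j = k.
Proof.
suff dim_le i l : pure_cell i C -> pure_cell l C -> (i <= l)%N.
  by move=> Cj Ck; apply/eqP; rewrite eqn_leq !dim_le.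
move=> Ci Cl; have [x Cx] := pure_cell_nonempty Ci.
have [V [hs [<- CV]]] := pure_cellE Ci Cx.
have [W [hs' [<- CW]]] := pure_cellE Cl Cx.
apply: dimvS; apply/subvP => v vV.
have [|e e0 eh] := @cell_of_open x V hs x v _ vV; first by rewrite -CV.
have := eh e; rewrite gtr0_norm // lexx -CV CW => /(_ isT)[].
rewrite addrC addKr => evW _.
by rewrite -[v](@scalerK _ _ e) ?gt_eqF // memvZ.
Qed.

Definition form_kernel u : {vspace 'rV[R]_n} := lker (linfun (mulmxr u : 'rV_n -> 'rV_1)).

Lemma mem_form_kernel u v : (v \in form_kernel u) = (form u v == 0).
Proof.
rewrite memv_ker lfunE /= /form; apply/eqP/eqP => [->|vu0]; first by rewrite mxE.
by apply/rowP => i; rewrite ord1 vu0 mxE.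
Qed.

Lemma dim_cap_form_kernel V u v : v \in V -> form u v != 0 ->
  \dim V = (\dim (V :&: form_kernel u)).+1.
Proof.
move=> vV uv0; rewrite -(limg_ker_dim (linfun (mulmxr u : 'rV_n -> 'rV_1)) V).
rewrite -/(form_kernel u) -[RHS]addn1; congr (_ + _)%N; apply/eqP; rewrite eqn_leq.
have -> : (\dim (linfun (mulmxr u : 'rV_n -> 'rV_1) @: V) <= 1)%N.
  by apply: leq_trans (dimvS (subvf _)) _; rewrite dimvf /= dim_matrix.
rewrite lt0n dimv_eq0; apply: contra uv0 => /eqP V0.
have := memv_img (linfun (mulmxr u : 'rV_n -> 'rV_1)) vV.
by rewrite V0 memv0 lfunE /= /form => /eqP->; rewrite mxE.
Qed.

Lemma above_opp u b : above (- u, - b) = below (u, b).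
Proof. by apply/seteqP; split=> x; rewrite /above /below /= form_oppr ltrN2. Qed.

Lemma cell_of_cons a V h hs : cell_of a V (h :: hs) = cell_of a V hs `&` above h.
Proof.
apply/seteqP; split=> x.
  move=> [xV xh]; split; last exact: xh (mem_head _ _).
  by split=> // h' hh'; apply: xh; rewrite inE hh' orbT.
by move=> [[xV xh] ?]; split=> // h'; rewrite inE => /orP[/eqP->|/xh].
Qed.

Lemma cell_of_convex a V hs x y (t : R) : 0 <= t -> t <= 1 ->
  cell_of a V hs x -> cell_of a V hs y -> cell_of a V hs (x + t *: (y - x)).
Proof.
move=> t0 t1 [xV xh] [yV yh]; split.
  have -> : y - x = (y - a) - (x - a) by rewrite opprB addrA subrK.
  by rewrite addrAC memvD // memvZ // memvB.
move=> h hh; have := xh h hh; have := yh h hh.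
rewrite /above /= formD formZ formD formN => hy hx.
have [->|t_lt1] : t = 1 \/ t < 1 by apply/predU1P; rewrite -le_eqVlt.
  by rewrite mul1r; lra.
have : 0 <= t * (form h.1 y - h.2) by rewrite mulr_ge0 // subr_ge0 ltW.
have : 0 < (1 - t) * (form h.1 x - h.2) by rewrite mulr_gt0 // subr_gt0.
by lra.
Qed.

(** If [C] misses the hyperplane, convexity leaves it on one side.  If [C] meets
    it at [x] and the form is constant along [C], then [C] lies in it.  Otherwise,
    by openness, one reaches both sides from [x] by moving along a direction [v] on
    which the form is positive, and the trace on the hyperplane loses exactly one
    dimension. *)
Lemma cell_cut j C h : pure_cell j C ->
  [\/ C `<=` above h, C `<=` on h, C `<=` below h |
    exists i, [/\ j = i.+1, pure_cell j (C `&` above h), pure_cell i (C `&` on h)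
     & pure_cell j (C `&` below h)]].
Proof.
case: h => u b Cj.
have [[x [Cx xb]]|Cb] := pselect (exists x, C x /\ form u x = b); last first.
  have [x0 Cx0] := pure_cell_nonempty Cj.
  have [V [hs [_ CE]]] := pure_cellE Cj Cx0.
  have cross x y : C x -> C y -> form u x < b -> b < form u y -> False.
    move=> Cx Cy xb yb; apply: Cb.
    (* The segment from x to y crosses the hyperplane at parameter t. *)
    pose t := (b - form u x) / (form u y - form u x).
    have d0 : 0 < form u y - form u x by lra.
    exists (x + t *: (y - x)); split.
      rewrite CE; apply: cell_of_convex; rewrite -?CE //.
        by rewrite divr_ge0 //; lra.
      by rewrite /t ler_pdivrMr //; lra.
    by rewrite formD formZ formD formN /t divfK ?gt_eqF // ; lra.
  case: (ltrgtP (form u x0) b) => [x0b|x0b|x0b].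
  - constructor 3 => y Cy; case: (above_on_below (u, b) y) => // [yb|yb].
      by case: (cross _ _ Cx0 Cy).
    by case: Cb; exists y.
  - constructor 1 => y Cy; case: (above_on_below (u, b) y) => // [yb|yb].
      by case: Cb; exists y.
    by case: (cross _ _ Cy Cx0).
  - by case: Cb; exists x0.
have [V [hs [dV CE]]] := pure_cellE Cj Cx.
have [[v [vV v0]]|V0] := pselect (exists v, v \in V /\ form u v != 0); last first.
  constructor 2 => y; rewrite CE => -[yV _]; rewrite /on /=.
  have : form u (y - x) = 0 by apply/eqP/negP => /negP ?; apply: V0; exists (y - x).
  by rewrite formD formN; lra.
constructor 4; exists (\dim (V :&: form_kernel u)); subst j.
wlog v1 : v vV v0 / 0 < form u v.
  move=> wl; have [|v1|/eqP] := ltrgtP 0 (form u v); first exact: wl.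
    by apply: (wl (- v)); rewrite ?memvN // formN ?oppr_eq0 //; lra.
  by rewrite eq_sym (negPf v0).
rewrite CE in Cx *; have [e e0 eh] := cell_of_open Cx vV.
split; first exact: (dim_cap_form_kernel vV).
- rewrite -cell_of_cons; apply: (@pure_cell_cell_of _ _ _ (x + e *: v)).
  rewrite cell_of_cons; split; first by apply: eh; rewrite gtr0_norm.
  by rewrite /above /= formD formZ xb ltrDl mulr_gt0.
- have -> : cell_of x V hs `&` on (u, b) = cell_of x (V :&: form_kernel u) hs.
    apply/seteqP; split=> y.
      move=> [[yV yh] yb]; split=> //.
      by rewrite memv_cap yV mem_form_kernel formD formN xb yb subrr eqxx.
    move=> [+ yh]; rewrite memv_cap => /andP[yV]; rewrite mem_form_kernel formD formN xb subr_eq0.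
    by move=> /eqP yb; split.
  apply: (@pure_cell_cell_of _ _ _ x); split; last exact: Cx.2.
  by rewrite subrr mem0v.
- rewrite -above_opp -cell_of_cons.
  apply: (@pure_cell_cell_of _ _ _ (x + (- e) *: v)).
  rewrite cell_of_cons; split; first by apply: eh; rewrite normrN gtr0_norm.
  by rewrite above_opp /below /= formD formZ xb mulNr gtrDl oppr_lt0 mulr_gt0.
Qed.

(** A cell is determined by the position of its points with respect to finitely
    many hyperplanes; those cutting out the affine span are the coordinates of the
    complementary projection [\1 - projv V]. *)
Lemma pure_cell_constraints j C : pure_cell j C ->
  exists es hs : seq ('cV[R]_n * R), C = [set x | (forall h, h \in es -> on h x) /\
                             (forall h, h \in hs -> above h x)].
Proof.
move=> Cj; have [a Ca] := pure_cell_nonempty Cj.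
have [V [hs [_ ->]]] := pure_cellE Cj Ca.
pose M := lin1_mx (\1 - projv V)%VF.
have ME v : v *m M = v - projv V v by rewrite mul_rV_lin1 /= add_lfunE opp_lfunE id_lfunE.
have mM v : (v \in V) = (v *m M == 0).
  rewrite ME subr_eq0; apply/idP/eqP => [/projv_id->//|->]; exact: memv_proj.
have fE v i : form (col i M) v = (v *m M) 0 i.
  by rewrite /form !mxE; apply: eq_bigr => l _; rewrite mxE.
exists [seq (col i M, form (col i M) a) | i : 'I_n], hs.
apply/seteqP; split=> x [xV xh]; split=> //.
  move=> h /mapP[i _ ->]; rewrite /on /=; apply/eqP.
  rewrite -subr_eq0 -formN -formD fE; move: xV; rewrite mM => /eqP->.
  by rewrite mxE.
rewrite mM; apply/eqP/rowP => i; rewrite -fE formD formN.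
by rewrite (xV (_, _) (map_f _ (mem_enum _ i))) /= subrr mxE.
Qed.

End Cells.

(** * The Euler integral and its uniqueness *)

Definition ind {T : Type} (A : set T) (x : T) : int := (`[< A x >] : nat)%:Z.

Lemma ind1 T (A : set T) x : A x -> ind A x = 1.
Proof. by move=> Ax; rewrite /ind asboolT. Qed.

Lemma ind0 T (A : set T) x : ~ A x -> ind A x = 0.
Proof. by move=> Ax; rewrite /ind asboolF. Qed.

Lemma ind_eqb T (A : set T) x (b : bool) : (A x <-> b) -> ind A x = (b : nat)%:Z.
Proof. by case: b => -[Ab bA]; [rewrite ind1 //; apply: bA|rewrite ind0 // => /Ab]. Qed.

Lemma ind_setU T (A B : set T) : A `&` B = set0 ->
  ind (A `|` B) = (fun x => ind A x - (0 - ind B x)).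
Proof.
move=> AB0; apply/funext => x.
have [Ax|nAx] := pselect (A x).
  have ABx : (A `|` B) x by left.
  rewrite (ind1 Ax) (ind1 ABx) ind0 // => Bx.
  have : (A `&` B) x by [].
  by rewrite AB0.
rewrite (ind0 nAx).
have [Bx|nBx] := pselect (B x).
  have ABx : (A `|` B) x by right.
  by rewrite (ind1 Bx) (ind1 ABx).
by rewrite !ind0 // => -[].
Qed.

Section Integral.
Context {R : realType} {n : nat}.
Implicit Types (A B C : set 'rV[R]_n) (f g : 'rV[R]_n -> int).
Implicit Types (h : 'cV[R]_n * R) (H : seq ('cV[R]_n * R)).

(** Subtraction alone generates all integer combinations of cells, since it
    yields opposites from [integral0].  No canonical expression of [f] is singled
    out: that [a] depends on [f] only is [integral_unique]. *)
Inductive euler_integral : ('rV[R]_n -> int) -> int -> Prop :=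
| integral_cell j C : pure_cell j C -> euler_integral (ind C) ((-1) ^+ j)
| integral0 : euler_integral (fun=> 0) 0
| integralB f g a b : euler_integral f a -> euler_integral g b ->
    euler_integral (fun x => f x - g x) (a - b).

Lemma eq_integral f g a : (forall x, f x = g x) ->
  euler_integral f a -> euler_integral g a.
Proof. by move=> /funext ->. Qed.

Lemma integralD f g a b : euler_integral f a -> euler_integral g b ->
  euler_integral (fun x => f x + g x) (a + b).
Proof.
move=> fa gb; have := integralB fa (integralB integral0 gb); rewrite sub0r opprK.
by apply: eq_integral => x; rewrite sub0r opprK.
Qed.

Lemma integral_sum (I : Type) (s : seq I) (F : I -> 'rV[R]_n -> int) (c : I -> int) :
  (forall i, euler_integral (F i) (c i)) ->
  euler_integral (fun x => \sum_(i <- s) F i x) (\sum_(i <- s) c i).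
Proof.
move=> Fc; elim: s => [|i s IH].
  by rewrite big_nil; apply: eq_integral integral0 => x; rewrite big_nil.
rewrite big_cons; apply: eq_integral (integralD (Fc i) IH) => x.
by rewrite big_cons.
Qed.

Definition cell_dim C : nat := xget 0%N [set j | pure_cell j C].

Lemma cell_dimE j C : pure_cell j C -> cell_dim C = j.
Proof. by move=> Cj; apply: xget_unique => // k Ck; apply: pure_cell_dim_unique Ck Cj. Qed.

(** Sum of [f] times (-1)^dim over the faces cut in [A] by the hyperplanes of
    [H], where [f] is sampled at an arbitrary point of each face. *)
Fixpoint face_sum H f A : int :=
  if H is h :: H' then
    face_sum H' f (A `&` above h) + face_sum H' f (A `&` on h) +
    face_sum H' f (A `&` below h)
  else if pselect (A !=set0) then f (xget 0 A) * (-1) ^+ cell_dim A else 0.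

Lemma face_sum_set0 H f : face_sum H f set0 = 0.
Proof.
elim: H => [|h H IH] /=; first by case: pselect => // -[].
by rewrite !set0I IH.
Qed.

Lemma face_sumB H f g A :
  face_sum H (fun x => f x - g x) A = face_sum H f A - face_sum H g A.
Proof.
elim: H A => [|h H IH] A /=; last by rewrite !IH; ring.
by case: pselect => ?; rewrite ?subr0 // mulrBl.
Qed.

Lemma face_sum0 H A : face_sum H (fun=> 0) A = 0.
Proof.
elim: H A => [|h H IH] A /=; last by rewrite !IH.
by case: pselect => ?; rewrite ?mul0r.
Qed.

(** Cutting does not change the sign sum, because
    (-1)^(i+1) + (-1)^i + (-1)^(i+1) = (-1)^(i+1). *)
Lemma face_sum1_cell H j C : pure_cell j C ->
  face_sum H (fun=> 1) C = (-1) ^+ j.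
Proof.
elim: H j C => [|h H IH] j C Cj /=.
  by case: pselect => [?|[]]; [rewrite mul1r (cell_dimE Cj)|apply: pure_cell_nonempty Cj].
have disj (A B : set 'rV[R]_n) : (forall x, A x -> B x -> False) -> A `&` B = set0.
  by move=> AB; apply/seteqP; split=> x // [/AB].
have [C1|C2|C3|[i [-> Ca Co Cb]]] := cell_cut h Cj.
- rewrite (setIidl C1) (IH _ _ Cj) !disj ?face_sum_set0 ?addr0 // => x /C1;
    by rewrite /above /on /below /=; lra.
- rewrite (setIidl C2) (IH _ _ Cj) !disj ?face_sum_set0 ?addr0 ?add0r // => x /C2;
    by rewrite /above /on /below /=; lra.
- rewrite (setIidl C3) (IH _ _ Cj) !disj ?face_sum_set0 ?addr0 ?add0r // => x /C3;
    by rewrite /above /on /below /=; lra.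
- by rewrite (IH _ _ Ca) (IH _ _ Co) (IH _ _ Cb) exprS; ring.
Qed.

Definition uncut h A : Prop :=
  [\/ A `<=` above h, A `<=` on h | A `<=` below h].

(** A face that no hyperplane bounding [C] cuts lies in [C] or misses it, so that
    sampling the indicator of [C] is the same as intersecting with [C].  The
    hypothesis on [A] makes the induction on [H] possible: each hyperplane bounding
    [C] is either still to be used or no longer cuts [A]. *)
Lemma face_sum_restrict H (es hs : seq ('cV[R]_n * R)) C A :
  C = [set x | (forall h, h \in es -> on h x) /\ (forall h, h \in hs -> above h x)] ->
  (forall h, h \in es ++ hs -> h \in H \/ uncut h A) ->
  face_sum H (ind C) A = face_sum H (fun=> 1) (A `&` C).
Proof.
move=> CE; elim: H A => [|h H IH] A AH.
  have dich : A `<=` C \/ A `&` C = set0.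
    have [|nAC] := pselect (A `<=` C); [by left|right].
    apply/seteqP; split=> x // -[Ax]; rewrite CE => -[xe xh].
    apply: nAC => y Ay; rewrite CE; split=> h hin.
      have hin' : h \in es ++ hs by rewrite mem_cat hin.
      have [//|] := AH h hin'.
      by case=> hA; have := hA _ Ax; have := hA _ Ay; have := xe _ hin;
         rewrite /above /on /below /=; lra.
    have hin' : h \in es ++ hs by rewrite mem_cat hin orbT.
    have [//|] := AH h hin'.
    by case=> hA; have := hA _ Ax; have := hA _ Ay; have := xh _ hin;
       rewrite /above /on /below /=; lra.
  case: dich => [AC|AC0].
    rewrite (setIidl AC) /=; case: pselect => // A0.
    by rewrite (ind1 (AC _ (xgetPex 0 A0))).
  rewrite AC0 (face_sum_set0 [::]) /=; case: pselect => // A0.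
  rewrite ind0 ?mul0r // => Cx.
  have : (A `&` C) (xget 0 A) by split=> //; apply: xgetPex.
  by rewrite AC0.
have sub_uncut k (D : set 'rV[R]_n) : uncut k A -> uncut k (A `&` D).
  by case=> kA; [constructor 1|constructor 2|constructor 3] => x [/kA].
have step (D : set 'rV[R]_n) : uncut h (A `&` D) ->
    face_sum H (ind C) (A `&` D) = face_sum H (fun=> 1) (A `&` C `&` D).
  move=> hD; rewrite setIAC; apply: IH => k /AH[|/sub_uncut]; last by right.
  by rewrite inE => /orP[/eqP->|]; [right|left].
rewrite /= (step (above h)) ?(step (on h)) ?(step (below h)) //.
- by constructor 3 => x [].
- by constructor 2 => x [].
- by constructor 1 => x [].
Qed.

(** The face sum is linear in [f], hence a cell-by-cell check is enough; it is
    stated for all larger [H] so that two expressions of [f] can be compared on a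
    common list. *)
Lemma integral_face_sum f a : euler_integral f a ->
  exists H0, forall H, {subset H0 <= H} -> a = face_sum H f setT.
Proof.
elim=> {f a} [j C Cj||f g a b _ [H1 IH1] _ [H2 IH2]].
- have [es [hs CE]] := pure_cell_constraints Cj.
  exists (es ++ hs) => H sH.
  rewrite (face_sum_restrict CE) ?setTI ?(face_sum1_cell _ Cj) //.
  by move=> h /sH; left.
- by exists [::] => H _; rewrite face_sum0.
- exists (H1 ++ H2) => H sH; rewrite face_sumB; congr (_ - _).
    by apply: IH1 => h h1; apply: sH; rewrite mem_cat h1.
  by apply: IH2 => h h2; apply: sH; rewrite mem_cat h2 orbT.
Qed.

Lemma integral_unique f a b : euler_integral f a -> euler_integral f b -> a = b.
Proof.
move=> /integral_face_sum[H1 E1] /integral_face_sum[H2 E2].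
rewrite (E1 (H1 ++ H2)) => [|h h1]; last by rewrite mem_cat h1.
by rewrite -E2 // => h h2; rewrite mem_cat h2 orbT.
Qed.

(** * Partitions of polyhedral sets into cells *)

(** Iterated disjoint unions of cells: any Euler measure, being additive on
    disjoint unions, takes the value [a] on [A]. *)
Inductive cell_partition : set 'rV[R]_n -> int -> Prop :=
| partition_cell j C : pure_cell j C -> cell_partition C ((-1) ^+ j)
| partition0 : cell_partition set0 0
| partitionU A B a b : cell_partition A a -> cell_partition B b ->
    A `&` B = set0 -> cell_partition (A `|` B) (a + b).

Lemma integral_partition A a : cell_partition A a -> euler_integral (ind A) a.
Proof.
elim=> {A a} [j C Cj||A B a b _ IHA _ IHB AB0].
- exact: integral_cell.
- by apply: eq_integral integral0 => x; rewrite ind0.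
- rewrite (ind_setU AB0); have := integralB IHA (integralB integral0 IHB).
  by rewrite sub0r opprK.
Qed.

Definition partitionable A : Prop := exists a, cell_partition A a.

Lemma partitionableU A B : partitionable A -> partitionable B ->
  A `&` B = set0 -> partitionable (A `|` B).
Proof. by move=> [a Aa] [b Bb] AB0; exists (a + b); apply: partitionU. Qed.

Lemma partitionable_cut A h : partitionable A ->
  [/\ partitionable (A `&` above h), partitionable (A `&` on h)
    & partitionable (A `&` below h)].
Proof.
have p0 : partitionable set0 by exists 0; apply: partition0.
have pc j C : pure_cell j C -> partitionable C by exists ((-1) ^+ j); apply: partition_cell.
have disj (B C : set 'rV[R]_n) : (forall x, B x -> C x -> False) -> B `&` C = set0.
  by move=> BC; apply/seteqP; split=> x // [/BC].
move=> [a]; elim=> {A a} [j C Cj||A B a b _ [A1 A2 A3] _ [B1 B2 B3] AB0].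
- have [C1|C2|C3|[i [_ Ca Co Cb]]] := cell_cut h Cj.
  + rewrite (setIidl C1).
    have -> : C `&` on h = set0.
      by apply: disj => x /C1; rewrite /above /on /below /=; lra.
    have -> : C `&` below h = set0.
      by apply: disj => x /C1; rewrite /above /on /below /=; lra.
    by split=> //; apply: pc Cj.
  + rewrite (setIidl C2).
    have -> : C `&` above h = set0.
      by apply: disj => x /C2; rewrite /above /on /below /=; lra.
    have -> : C `&` below h = set0.
      by apply: disj => x /C2; rewrite /above /on /below /=; lra.
    by split=> //; apply: pc Cj.
  + rewrite (setIidl C3).
    have -> : C `&` above h = set0.
      by apply: disj => x /C3; rewrite /above /on /below /=; lra.
    have -> : C `&` on h = set0.
      by apply: disj => x /C3; rewrite /above /on /below /=; lra.
    by split=> //; apply: pc Cj.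
  + by split; [apply: pc Ca|apply: pc Co|apply: pc Cb].
- by rewrite !set0I.
- have disjI D : (A `&` D) `&` (B `&` D) = set0 by rewrite setIACA AB0 set0I.
  by rewrite !setIUl; split; apply: partitionableU.
Qed.

(** Partitionable sets are not obviously stable under union or complement, as the
    cells of two partitions may overlap.  Sets that cut every partitionable set into
    partitionable pieces visibly form a Boolean algebra, which contains the
    half-spaces and hyperplanes, hence the cells. *)
Definition cutter B : Prop := forall A, partitionable A ->
  partitionable (A `&` B) /\ partitionable (A `&` ~` B).

Lemma cutterC B : cutter B -> cutter (~` B).
Proof. by move=> cB A /cB[]; rewrite setCK. Qed.

Lemma cutterI B C : cutter B -> cutter C -> cutter (B `&` C).
Proof.
move=> cB cC A /cB[AB AnB]; have [ABC ABnC] := cC _ AB.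
split; first by rewrite setIA.
have -> : A `&` ~` (B `&` C) = (A `&` ~` B) `|` (A `&` B `&` ~` C).
  rewrite setCI setIUr; apply/seteqP; split=> x; last by move=> [|[[]]]; [left|right].
  move=> [|[Ax nCx]]; first by left.
  by have [Bx|nBx] := pselect (B x); [right|left].
by apply: partitionableU => //; apply/seteqP; split=> x // [[_ nB] [[_ /nB]]].
Qed.

Lemma cutterU B C : cutter B -> cutter C -> cutter (B `|` C).
Proof.
by move=> cB cC; rewrite -[_ `|` _]setCK setCU; apply/cutterC/cutterI; apply: cutterC.
Qed.

Lemma cutter0 : cutter set0.
Proof. by move=> A pA; rewrite setI0 setC0 setIT; split=> //; exists 0; apply: partition0. Qed.

Lemma cutter_above h : cutter (above h).
Proof.
move=> A /(partitionable_cut h)[A1 A2 A3]; split=> //.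
have -> : A `&` ~` above h = (A `&` on h) `|` (A `&` below h).
  rewrite -setIUr; congr (_ `&` _); apply/seteqP; split=> x.
    by move=> nx; case: (above_on_below h x) => // ?; [left|right].
  by move=> [|]; rewrite /above /on /below /=; lra.
by apply: partitionableU => //; apply/seteqP; split=> x // [[_ +] [_]];
  rewrite /on /below /=; lra.
Qed.

Lemma cutter_on h : cutter (on h).
Proof.
move=> A /(partitionable_cut h)[A1 A2 A3]; split=> //.
have -> : A `&` ~` on h = (A `&` above h) `|` (A `&` below h).
  rewrite -setIUr; congr (_ `&` _); apply/seteqP; split=> x.
    by move=> nx; case: (above_on_below h x) => // ?; [left|right].
  by move=> [|]; rewrite /above /on /below /=; lra.
by apply: partitionableU => //; apply/seteqP; split=> x // [[_ +] [_]];
  rewrite /above /below /=; lra.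
Qed.

Lemma cutter_all H (F : 'cV[R]_n * R -> set 'rV[R]_n) : (forall h, cutter (F h)) ->
  cutter [set x | forall h, h \in H -> F h x].
Proof.
move=> cF; elim: H => [|h H IH].
  by have := cutterC cutter0; rewrite setC0; congr cutter; apply/seteqP; split.
have := cutterI (cF h) IH; congr cutter; apply/seteqP; split=> x.
  by move=> [xh xH] k; rewrite inE => /orP[/eqP->|/xH].
by move=> xH; split=> [|k kH]; apply: xH; rewrite inE ?eqxx // kH orbT.
Qed.

Lemma cutter_cell j C : pure_cell j C -> cutter C.
Proof.
move=> /pure_cell_constraints[es [hs ->]].
by apply: cutterI; apply: cutter_all; [exact: cutter_on|exact: cutter_above].
Qed.

Lemma pure_cellT : pure_cell n (@setT 'rV[R]_n).
Proof.
have -> : @setT 'rV[R]_n = cell_of 0 fullv [::].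
  by apply/seteqP; split=> x // _; split=> //; apply: memvf.
have dimT : \dim (@fullv R 'rV[R]_n) = n.
  by rewrite dimvf dim_matrix; apply: mul1n.
have T0 : cell_of 0 (@fullv R 'rV[R]_n) [::] 0 by split=> //; apply: memvf.
by have := pure_cell_cell_of T0; rewrite dimT.
Qed.

Lemma polyhedral_partitionable A : polyhedral A -> partitionable A.
Proof.
move=> [m [C [Ccell ->]]].
have cu (s : seq 'I_m) : cutter [set x | exists2 i, i \in s & C i x].
  elim: s => [|i s IH].
    by have := cutter0; congr cutter; apply/seteqP; split=> x // [].
  have [j Cj] := Ccell i; have := cutterU (cutter_cell Cj) IH.
  congr cutter; apply/seteqP; split=> x.
    move=> [Cx|[k ks Cx]]; first by exists i; rewrite ?mem_head.
    by exists k => //; rewrite inE ks orbT.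
  by move=> [k]; rewrite inE => /orP[/eqP->|ks] Cx; [left|right; exists k].
have [] := cu (enum 'I_m) setT.
  by exists ((-1) ^+ n); apply: partition_cell pure_cellT.
rewrite setTI => + _; congr partitionable; apply/seteqP; split=> x [i _ Cx].
  by exists i.
by exists i; rewrite // mem_enum.
Qed.

Lemma partition_polyhedral A a : cell_partition A a -> polyhedral A.
Proof.
elim=> {A a} [j C Cj||A B a b _ [m1 [C1 [H1 ->]]] _ [m2 [C2 [H2 ->]]] _].
- exists 1%N, (fun=> C); split; first by move=> _; exists j.
  by apply/seteqP; split=> x; [exists 0|case].
- by exists 0%N, (fun=> set0); split; [case|apply/seteqP; split=> x // [[]]].
- exists (m1 + m2)%N, (fun i => match fintype.split i with inl i => C1 i | inr i => C2 i end).
  split; first by move=> i; case: fintype.split.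
  apply/seteqP; split=> x.
    move=> [[i _ Cx]|[i _ Cx]].
      by exists (lshift m2 i); rewrite // (unsplitK (inl i)).
    by exists (rshift m1 i); rewrite // (unsplitK (inr i)).
  by move=> [i _]; case: fintype.split => k Cx; [left|right]; exists k.
Qed.

(** * The Euler measure *)

Lemma euler_measure_exists :
  is_euler_measure (fun A => xget 0 [set a | euler_integral (ind A) a]).
Proof.
have valE A a : euler_integral (ind A) a ->
    xget 0 [set a | euler_integral (ind A) a] = a.
  by move=> Aa; apply: xget_unique => // b Ab; apply: integral_unique Ab Aa.
split=> [A B|j C Cj]; last by apply: valE; apply: integral_cell.
move=> /polyhedral_partitionable[a Aa] /polyhedral_partitionable[b Bb] AB0.
rewrite (valE _ _ (integral_partition Aa)) (valE _ _ (integral_partition Bb)).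
by apply: valE; apply: integral_partition; apply: partitionU.
Qed.

(** [euler_measure] is an arbitrary Euler measure, so that only additivity and the
    values on cells are available. *)
Lemma euler_measure_partition A a : cell_partition A a -> euler_measure A = a.
Proof.
have [chiU chiC] : is_euler_measure (@euler_measure R n).
  by apply: xgetPex; eexists; exact: euler_measure_exists.
have p0 := partition_polyhedral partition0.
elim=> {A a} [j C Cj||A B a b Aa IHA Bb IHB AB0]; first exact: chiC.
  by have := chiU _ _ p0 p0 (setI0 _); rewrite setU0 => /eqP;
    rewrite -subr_eq0 opprD addrA subrr sub0r oppr_eq0 => /eqP.
by rewrite chiU ?IHA ?IHB //; [apply: partition_polyhedral Aa|apply: partition_polyhedral Bb].
Qed.

Lemma integral_polyhedral A : polyhedral A -> euler_integral (ind A) (euler_measure A).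
Proof.
move=> /polyhedral_partitionable[a Aa].
by rewrite (euler_measure_partition Aa); apply: integral_partition.
Qed.

End Integral.

(** * Images and products *)

Section LinearMaps.
Context {R : realType}.

Lemma form_lin1 m p (g : {linear 'rV[R]_p -> 'rV[R]_m}) (u : 'cV[R]_m) y :
  form (lin1_mx g *m u) y = form u (g y).
Proof. by rewrite /form mulmxA mul_rV_lin1. Qed.

Definition pull_form m p (g : {linear 'rV[R]_p -> 'rV[R]_m}) (h : 'cV[R]_m * R) :
  'cV[R]_p * R := (lin1_mx g *m h.1, h.2).

Lemma above_pull_form m p (g : {linear 'rV[R]_p -> 'rV[R]_m}) hs y :
  (forall h, h \in map (pull_form g) hs -> above h y) <->
  (forall h, h \in hs -> above h (g y)).
Proof.
split=> H h.
  by move=> /(map_f (pull_form g))/H; rewrite /above /= form_lin1.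
by move=> /mapP[h' /H + ->]; rewrite /above /= form_lin1.
Qed.

Lemma dim_limg_cancel m p (f : {linear 'rV[R]_m -> 'rV[R]_p})
    (g : {linear 'rV[R]_p -> 'rV[R]_m}) (V : {vspace 'rV[R]_m}) :
  cancel f g -> \dim (linfun f @: V) = \dim V.
Proof.
move=> fK; rewrite limg_dim_eq //; apply/eqP; rewrite -subv0; apply/subvP => v.
rewrite memv_cap memv_ker lfunE /= memv0 => /andP[_ /eqP fv0].
by rewrite -(fK v) fv0 linear0.
Qed.

(** The set is the image of [C] under [f], written with the left inverse [g]
    because half-spaces pull back along [g] whereas they do not push forward. *)
Lemma pure_cell_image m p (f : {linear 'rV[R]_m -> 'rV[R]_p})
    (g : {linear 'rV[R]_p -> 'rV[R]_m}) j C : cancel f g ->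
  pure_cell j C -> pure_cell j [set y | f (g y) = y /\ C (g y)].
Proof.
move=> fK Cj; have [a Ca] := pure_cell_nonempty Cj.
have [V [hs [<- CE]]] := pure_cellE Cj Ca.
rewrite -(dim_limg_cancel V fK).
have -> : [set y | f (g y) = y /\ C (g y)] =
    cell_of (f a) (linfun f @: V) (map (pull_form g) hs).
  apply/seteqP; split=> y.
    rewrite CE => -[fgy [gV gh]]; split; last exact/above_pull_form.
    by rewrite -{1}fgy -linearB -(lfunE f) memv_img.
  move=> [/memv_imgP[v vV +] /above_pull_form gh]; rewrite lfunE /= => yE.
  have {}yE : y = f (a + v) by rewrite linearD -yE addrC subrK.
  rewrite yE fK in gh *; split=> //; rewrite CE; split=> //.
  by rewrite addrC addKr.
apply: (@pure_cell_cell_of _ _ _ _ _ (f a)).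
by split; [rewrite subrr mem0v|apply/above_pull_form; rewrite fK; move: Ca; rewrite CE => -[]].
Qed.

(** Push-forward of [phi] along the injection [f]: the factor is the indicator of
    the range of [f]. *)
Lemma integral_image m p (f : {linear 'rV[R]_m -> 'rV[R]_p})
    (g : {linear 'rV[R]_p -> 'rV[R]_m}) phi a : cancel f g ->
  euler_integral phi a ->
  euler_integral (fun y => phi (g y) * ((f (g y) == y) : nat)%:Z) a.
Proof.
move=> fK; elim=> {phi a} [j C Cj||phi psi a b _ IHphi _ IHpsi].
- apply: (eq_integral _ (integral_cell (pure_cell_image fK Cj))) => y.
  have [Cgy|nCgy] := pselect (C (g y)).
    rewrite (ind1 Cgy) mul1r; apply: ind_eqb; split=> [[/eqP]//|/eqP].
    by split.
  by rewrite (ind0 nCgy) mul0r ind0 // => -[].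
- by apply: (eq_integral _ (@integral0 R p)) => y; rewrite mul0r.
- by apply: (eq_integral _ (integralB IHphi IHpsi)) => y; rewrite mulrBl.
Qed.

Section Product.
Context {m q p : nat} (i1 : {linear 'rV[R]_m -> 'rV[R]_p}) (p1 : {linear 'rV[R]_p -> 'rV[R]_m})
  (i2 : {linear 'rV[R]_q -> 'rV[R]_p}) (p2 : {linear 'rV[R]_p -> 'rV[R]_q}).

(** The target space is the direct sum of the other two, with injections [i1],
    [i2] and projections [p1], [p2].  This form avoids identifying
    ['rV_(k.+1 * n)] with ['rV_(n + k * n)]. *)
Definition biproduct : Prop :=
  [/\ cancel i1 p1, cancel i2 p2, forall x, p2 (i1 x) = 0, forall x, p1 (i2 x) = 0
    & forall z, i1 (p1 z) + i2 (p2 z) = z].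

Context (bip : biproduct).

Lemma pure_cell_prod i j C D : pure_cell i C -> pure_cell j D ->
  pure_cell (i + j) [set z | C (p1 z) /\ D (p2 z)].
Proof.
have [i1K i2K p2i1 p1i2 ip] := bip.
move=> Ci Dj; have [a Ca] := pure_cell_nonempty Ci.
have [b Db] := pure_cell_nonempty Dj.
have [V [hs [<- CE]]] := pure_cellE Ci Ca.
have [W [ks [<- DE]]] := pure_cellE Dj Db.
pose U := (linfun i1 @: V + linfun i2 @: W)%VS.
have memU z : (z \in U) = (p1 z \in V) && (p2 z \in W).
  apply/memv_addP/andP => [[_ /memv_imgP[v vV ->] [_ /memv_imgP[w wW ->] ->]]|[zV zW]].
    by rewrite !lfunE /= !linearD i1K i2K p2i1 p1i2 addr0 add0r.
  exists (i1 (p1 z)); first by rewrite -(lfunE i1) memv_img.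
  by exists (i2 (p2 z)); [rewrite -(lfunE i2) memv_img|rewrite ip].
have -> : (\dim V + \dim W)%N = \dim U.
  rewrite dimv_disjoint_sum ?(dim_limg_cancel _ i1K) ?(dim_limg_cancel _ i2K) //.
  apply/eqP; rewrite -subv0; apply/subvP => z; rewrite memv_cap memv0.
  move=> /andP[/memv_imgP[v _ ->] /memv_imgP[w _]]; rewrite !lfunE /= => E.
  by rewrite -(i1K v) E p1i2 linear0.
have -> : [set z | C (p1 z) /\ D (p2 z)] =
    cell_of (i1 a + i2 b) U (map (pull_form p1) hs ++ map (pull_form p2) ks).
  have p1E z : p1 (z - (i1 a + i2 b)) = p1 z - a.
    by rewrite linearB linearD i1K p1i2 addr0.
  have p2E z : p2 (z - (i1 a + i2 b)) = p2 z - b.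
    by rewrite linearB linearD i2K p2i1 add0r.
  apply/seteqP; split=> z; rewrite /cell_of /= memU p1E p2E.
    rewrite CE DE => -[[zV zh] [zW zk]]; split; first by rewrite zV zW.
    move=> h; rewrite mem_cat => /orP[]; move: h; exact/above_pull_form.
  move=> [/andP[zV zW] zhk]; rewrite CE DE; split; split=> //.
    by apply/above_pull_form => h hh; apply: zhk; rewrite mem_cat hh.
  by apply/above_pull_form => h hh; apply: zhk; rewrite mem_cat hh orbT.
apply: (@pure_cell_cell_of _ _ _ _ _ (i1 a + i2 b)); split.
  by rewrite subrr mem0v.
move: Ca Db; rewrite CE DE => -[_ ah] [_ bk] h.
rewrite mem_cat => /orP[]; move: h; apply/above_pull_form.
  by rewrite linearD i1K p1i2 addr0.
by rewrite linearD i2K p2i1 add0r.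
Qed.

Lemma integral_prod phi psi a b : euler_integral phi a -> euler_integral psi b ->
  euler_integral (fun z => phi (p1 z) * psi (p2 z)) (a * b).
Proof.
move=> phia psib.
elim: phia => {phi a} [i C Ci||phi phi' a a' _ IH _ IH'].
- elim: psib => {psi b} [j D Dj||psi psi' b b' _ IH _ IH'].
  + rewrite -exprD; have := integral_cell (pure_cell_prod Ci Dj).
    congr euler_integral; apply/funext => z.
    have [Cz|nCz] := pselect (C (p1 z)); last first.
      by rewrite (ind0 nCz) mul0r ind0 // => -[].
    have [Dz|nDz] := pselect (D (p2 z)); last first.
      by rewrite (ind0 nDz) mulr0 ind0 // => -[].
    by rewrite (ind1 Cz) (ind1 Dz) mulr1 ind1.
  + by rewrite mulr0; apply: (eq_integral _ (@integral0 R p)) => z; rewrite mulr0.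
  + by rewrite mulrBr; apply: (eq_integral _ (integralB IH IH')) => z; rewrite mulrBr.
- by rewrite mul0r; apply: (eq_integral _ (@integral0 R p)) => z; rewrite mul0r.
- by rewrite mulrBl; apply: (eq_integral _ (integralB IH IH')) => z; rewrite mulrBl.
Qed.

End Product.
End LinearMaps.

(** * Tuples of distinct points *)

Section Configurations.
Context {R : realType} {n : nat}.
Implicit Types (P : set 'rV[R]_n).

Lemma component_ext k (x y : 'rV[R]_(k * n)) :
  (forall i, component x i = component y i) -> x = y.
Proof.
move=> xy; rewrite -[x]vec_mxK -[y]vec_mxK; congr mxvec.
by apply/row_matrixP => i; apply: xy.
Qed.

(** The maps used on tuples send the components of the result to given components
    of the argument, or to 0 ([component_select]); as matrix products they are
    linear. *)
Definition select_mx k l (s : 'I_l -> option 'I_k) : 'M[R]_(l, k) :=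
  \matrix_(i, j) (s i == Some j)%:R.

Definition select k l (s : 'I_l -> option 'I_k) :
    {linear 'rV[R]_(k * n) -> 'rV[R]_(l * n)} :=
  mxvec \o mulmx (select_mx s) \o vec_mx.

Lemma component_select k l (s : 'I_l -> option 'I_k) x i :
  component (select s x) i = if s i is Some j then component x j else 0.
Proof.
rewrite /component /select /= mxvecK row_mul.
have -> : row i (select_mx s) = if s i is Some j then delta_mx 0 j else 0.
  apply/rowP => j; rewrite !mxE; case: (s i) => [j'|]; rewrite mxE //=.
  by rewrite eq_sym; congr ((_ : bool)%:R).
by case: (s i) => [j|]; rewrite ?mul0mx // -rowE.
Qed.

Definition head_component k : {linear 'rV[R]_(k.+1 * n) -> 'rV[R]_n} :=
  row ord0 \o vec_mx.

Definition head_inclusion k : {linear 'rV[R]_n -> 'rV[R]_(k.+1 * n)} :=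
  mxvec \o mulmx (delta_mx ord0 0).

Lemma component_head_inclusion k (p : 'rV[R]_n) (i : 'I_k.+1) :
  component (head_inclusion k p) i = if i == ord0 then p else 0.
Proof.
rewrite /component /head_inclusion /= mxvecK row_mul.
have -> : row i (delta_mx ord0 0 : 'M[R]_(k.+1, 1)) = (i == ord0)%:R%:M.
  by apply/rowP => j; rewrite ord1 !mxE eqxx andbT mulr1n.
by rewrite mul_scalar_mx; case: eqP => _; rewrite ?scale1r ?scale0r.
Qed.

Lemma head_componentE k (z : 'rV[R]_(k.+1 * n)) : head_component k z = component z ord0.
Proof. by []. Qed.

Definition tail k := select (fun i : 'I_k => Some (lift ord0 i)).
Definition tail_inclusion k := select (unlift (@ord0 k)).
(** Prepends a copy of the i-th component. *)
Definition duplicate k (i : 'I_k) :=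
  select (fun j : 'I_k.+1 => Some (odflt i (unlift ord0 j))).

Lemma biproduct_tail_head k :
  biproduct (tail_inclusion k) (tail k) (head_inclusion k) (head_component k).
Proof.
split=> [x|x|x|x|z].
- by apply: component_ext => i; rewrite !component_select liftK.
- by rewrite head_componentE component_head_inclusion.
- by rewrite head_componentE component_select unlift_none.
- by apply: component_ext => i; rewrite component_select component_head_inclusion
    /component linear0 row0.
- apply: component_ext => i.
  rewrite {1}/component !linearD /= -![row i _]/(component _ i).
  rewrite component_select component_head_inclusion.
  case: unliftP => [j ->|->].
    by rewrite component_select addr0.
  by rewrite eqxx add0r.
Qed.

Definition configurations k P : set 'rV[R]_(k * n) :=
  [set x | (forall i, P (component x i)) /\ injective (component x)].

Arguments configurations : clear implicits.

Lemma configurationsS k P z : configurations k.+1 P z <->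
  [/\ configurations k P (tail k z), P (head_component k z)
    & forall i, head_component k z <> component (tail k z) i].
Proof.
have tE i : component (tail k z) i = component z (lift ord0 i) by rewrite component_select.
rewrite head_componentE; split=> [[zP zI]|[[tP tI] hP ht]].
  split=> //; last by move=> i; rewrite tE => /zI /eqP; rewrite (negPf (neq_lift _ _)).
  split=> [i|i j]; rewrite !tE //.
  by move=> /zI /lift_inj.
split=> [i|i j].
  by case: (unliftP ord0 i) => [j ->|->//]; rewrite -tE.
case: (unliftP ord0 i) => [i' ->|->]; case: (unliftP ord0 j) => [j' ->|->] //.
- by rewrite -!tE => /tI ->.
- by rewrite -tE => /esym /ht.
- by rewrite -tE => /ht.
Qed.

Lemma duplicate_tail k (i : 'I_k) z : (duplicate i (tail k z) = z) <->
  head_component k z = component (tail k z) i.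
Proof.
rewrite head_componentE; split=> [{1}<-|hE].
  by rewrite component_select unlift_none.
apply: component_ext => j; rewrite component_select.
by case: (unliftP ord0 j) => [j' ->|->]; rewrite /= ?hE // component_select.
Qed.

(** Induction on [k]: the tuples (p, t) with t in F_k and p in P, minus those with
    p = t_i for some i.  These last conditions exclude each other since the
    components of t are distinct. *)
Lemma integral_configurations P chi k : euler_integral (ind P) chi ->
  euler_integral (ind (configurations k P)) (\prod_(i < k) (chi - (i : nat)%:Z)).
Proof.
move=> Pchi; elim: k => [|k IH].
  rewrite big_ord0 -[1](expr0 (-1)).
  have -> : configurations 0 P = setT by apply/seteqP; split=> // x _; split=> -[].
  exact: (integral_cell pure_cellT).
have prod := integral_prod (biproduct_tail_head k) IH Pchi.
have dupK i : cancel (@duplicate k i) (tail k).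
  by move=> x; apply: component_ext => j; rewrite !component_select liftK.
have dup := integral_sum (index_enum 'I_k) (fun i => integral_image (dupK i) IH).
rewrite big_ord_recr /= mulrBr.
have -> : \prod_(i < k) (chi - i%:Z) * k%:Z =
    \sum_(i < k) \prod_(i < k) (chi - i%:Z).
  by rewrite sumr_const card_ord -mulr_natr natz.
apply: eq_integral (integralB prod dup) => z.
have [tC|ntC] := pselect (configurations k P (tail k z)); last first.
  have nzC : ~ configurations k.+1 P z by case/configurationsS.
  by rewrite (ind0 ntC) (ind0 nzC) mul0r big1 // => i _; rewrite mul0r.
rewrite (ind1 tC) mul1r; under eq_bigr => i _ do rewrite mul1r.
have [[i0 hE]|nE] := pselect (exists i, head_component k z = component (tail k z) i).
  have nzC : ~ configurations k.+1 P z by case/configurationsS => _ _ /(_ i0).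
  have Ph : P (head_component k z) by rewrite hE; apply: tC.1.
  rewrite (ind0 nzC) (ind1 Ph).
  rewrite (bigD1 i0) //= big1 ?addr0.
    by move/duplicate_tail: hE => /eqP->.
  move=> i ii0; case: eqP => // /duplicate_tail; rewrite hE => /tC.2 ie.
  by rewrite ie eqxx in ii0.
rewrite big1 ?subr0 => [|i _]; last first.
  by case: eqP => // /duplicate_tail ?; case: nE; exists i.
have [Ph|nPh] := pselect (P (head_component k z)).
  have zC : configurations k.+1 P z.
    by apply/configurationsS; split=> // i hE; apply: nE; exists i.
  by rewrite (ind1 Ph) (ind1 zC).
have nzC : ~ configurations k.+1 P z by case/configurationsS.
by rewrite (ind0 nPh) (ind0 nzC).
Qed.

(** * Orbits of the symmetric group *)

Lemma component_permute k (s : 'S_k) (x : 'rV[R]_(k * n)) i :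
  component (permute_components s x) i = component x (s i).
Proof. by rewrite /component /permute_components mxvecK; apply/rowP => j; rewrite !mxE. Qed.

Lemma permute_inj k (x : 'rV[R]_(k * n)) : injective (component x) ->
  injective (fun s : 'S_k => permute_components s x).
Proof.
move=> xI s t st; apply/permP => i; apply: xI.
by rewrite -!component_permute st.
Qed.

Lemma configurations_permute k P (s : 'S_k) (x : 'rV[R]_(k * n)) :
  configurations k P x -> configurations k P (permute_components s x).
Proof.
move=> [xP xI]; split=> [i|i j]; rewrite !component_permute // => /xI.
exact: perm_inj.
Qed.

Lemma configurations_free k P (x : 'rV[R]_(k * n)) :
  configurations k P x -> free_orbit P (Sk_orbit x).
Proof.
move=> [xP xI]; split; first by exists x.
have sizeE : size (enum {: 'S_k}) = k`! by rewrite -cardE card_Sn.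
have -> : Sk_orbit x = (fun i => permute_components (nth 1%g (enum {: 'S_k}) i) x) @` `I_(k`!).
  apply/seteqP; split=> y; last by move=> [i _ <-]; exists (nth 1%g (enum {: 'S_k}) i).
  move=> [s _ <-]; exists (index s (enum {: 'S_k})); last by rewrite nth_index // mem_enum.
  by rewrite /= -sizeE index_mem mem_enum.
apply: inj_card_eq => i j; rewrite !inE /= => ik jk /(permute_inj xI)/eqP.
by rewrite nth_uniq ?sizeE ?enum_uniq // => /eqP.
Qed.

(** If two components of [y] agree, exchanging them fixes [y]; the k! points of
    the orbit are then reached by permutations other than that transposition, and
    there are only k! - 1 of these. *)
Lemma free_configurations k P (O : set 'rV[R]_(k * n)) x :
  free_orbit P O -> O x -> configurations k P x.
Proof.
move=> [[y yP ->]] card_O [s _ <-]; apply: configurations_permute; split=> // i j yij.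
apply/eqP; apply/negPn/negP => ij.
have tyE : permute_components (tperm i j) y = permute_components 1 y.
  apply: component_ext => l; rewrite !component_permute perm1.
  by case: tpermP => [->|->|].
have t1 : tperm i j != 1%g.
  by apply: contra ij => /eqP/permP/(_ i); rewrite tpermL perm1 => ->.
have : (`I_(k`!) #<= Sk_orbit y)%card by move: card_O; rewrite card_eq_le => /andP[].
move=> /card_leP[h].
pose e (l : 'I_(k`!)) : `I_(k`!) := SigSub (@mem_set _ `I_(k`!) l (ltn_ord l)).
have hO (l : 'I_(k`!)) : exists2 s : 'S_k, s != tperm i j & permute_components s y = \val (h (e l)).
  have [s' _ <-] := set_valP (h (e l)).
  have [->|s't] := eqVneq s' (tperm i j); last by exists s'.
  by exists 1%g; rewrite 1?eq_sym.
(* G injects k! indices into the permutations, hence is onto, but misses tperm i j. *)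
pose G l := sval (cid2 (hO l)).
have GI : injective G.
  move=> l1 l2 G12; apply: val_inj.
  suff /(congr1 val) : e l1 = e l2 by [].
  apply: (@inj _ _ _ h); rewrite ?inE //; apply: val_inj.
  by rewrite /= -(svalP (cid2 (hO l1))).2 -(svalP (cid2 (hO l2))).2 -/(G l1) G12.
have /codomP[l tG] : tperm i j \in codom G.
  by apply: inj_card_onto => //; rewrite card_ord card_Sn.
by have := (svalP (cid2 (hO l))).1; rewrite -/(G l) -tG eqxx.
Qed.

(** The tuple [x] has distinct components in [P] exactly when its orbit is free;
    then one point of the orbit lies in [Q], and one permutation leads to it. *)
Lemma binomial_set_multiplicity k P (Q : set 'rV[R]_(k * n)) x :
  is_binomial_set P Q ->
  \sum_(s : 'S_k) ind Q (permute_components s x) = ind (configurations k P) x.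
Proof.
move=> [_ _ Qrep Qfree].
have [xC|nxC] := pselect (configurations k P x); last first.
  rewrite ind0 // big1 // => s _; rewrite ind0 // => /Qfree[O Ofree sO]; apply: nxC.
  have := configurations_permute s^-1 (free_configurations Ofree sO).
  congr (configurations k P _); apply: component_ext => i.
  by rewrite !component_permute permKV.
have [y QO] := Qrep _ (configurations_free xC).
have : [set y] y by [].
rewrite -QO => -[Qy [s0 _ s0y]].
rewrite (ind1 xC) (bigD1 s0) //= s0y (ind1 Qy) big1 ?addr0 // => s ss0.
rewrite ind0 // => Qs.
have : (Q `&` Sk_orbit x) (permute_components s x) by split=> //; exists s.
rewrite QO /= -s0y => /(permute_inj xC.2) E.
by rewrite E eqxx in ss0.
Qed.

Lemma integral_permute k (Q : set 'rV[R]_(k * n)) (s : 'S_k) q :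
  euler_integral (ind Q) q ->
  euler_integral (fun x => ind Q (permute_components s x)) q.
Proof.
pose sel (t : 'S_k) := select (fun i => Some (t i)).
have selE t x : sel t x = permute_components t x.
  by apply: component_ext => i; rewrite component_select component_permute.
have selK t : cancel (sel t^-1)%g (sel t).
  by move=> x; apply: component_ext => i; rewrite !selE !component_permute permK.
have selVK t : cancel (sel t) (sel t^-1)%g.
  by move=> x; apply: component_ext => i; rewrite !selE !component_permute permKV.
move=> /(integral_image (selK s)); apply: eq_integral => x.
by rewrite selVK eqxx mulr1 selE.
Qed.

End Configurations.

(** The two computations of the integral of 1_F_k are compared. *)
Theorem mainTheorem1 (R : realType) (n k : nat) (hn : (1 <= n)%N)
    (P : set 'rV[R]_n) (hP : polyhedral P)
    (Q : set 'rV[R]_(k * n)) (hQ : is_binomial_set P Q) :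
  (euler_measure Q)%:~R = int_binomial (euler_measure P) k.
Proof.
have [polyQ _ _ _] := hQ.
have sumQ := integral_sum (index_enum 'S_k)
  (fun s => integral_permute s (integral_polyhedral polyQ)).
have confP := integral_configurations k (integral_polyhedral hP).
have E : euler_measure Q * (k`!)%:Z =
    \prod_(i < k) (euler_measure P - (i : nat)%:Z).
  apply: integral_unique confP.
  have -> : euler_measure Q * (k`!)%:Z = \sum_(s : 'S_k) euler_measure Q.
    by rewrite sumr_const card_Sn -mulr_natr natz.
  by apply: eq_integral sumQ => x; apply: binomial_set_multiplicity.
rewrite /int_binomial.
have k0 : (k`!)%:R != 0 :> rat by rewrite pnatr_eq0 -lt0n fact_gt0.
apply: (mulIf k0); rewrite divfK //.
rewrite -[RHS](_ : (\prod_(i < k) (euler_measure P - (i : nat)%:Z))%:~R = _).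
  by rewrite -E rmorphM.
by rewrite rmorph_prod; apply: eq_bigr => i _; rewrite rmorphB.
Qed.
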